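(* Let $X$ be a real Banach space with $X \neq \{0\}$. Then $X$ admits a tiling of order $2$ by closed convex bounded bodies; that is, there is a family $\tau$ of closed, convex, bounded bodies in $X$ whose union is $X$, whose interiors are pairwise disjoint, and such that no point of $X$ belongs to more than two members of $\tau$.
   Context: A body in $X$ is a nonempty proper subset of $X$ that is contained in the closure of its interior, this interior being connected. A covering of $X$ is a family of proper subsets of $X$ whose union is $X$. A tiling of $X$ is a covering whose members (tiles) are closed bodies with pairwise disjoint interiors. The order of a covering $\tau$ is the supremum of those $n \in \mathbb{N}$ for which there exist $n$ members of $\tau$ having a common point; order $2$ means no point of $X$ lies in more than two members. *)

(* Defs.v *)
From HB Require Import structures.
From mathcomp Require Import all_boot all_order all_algebra.
From mathcomp Require Import all_classical all_reals all_analysis.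
Set Implicit Arguments. Unset Strict Implicit. Unset Printing Implicit Defensive.
Import Order.TTheory GRing.Theory Num.Theory.
Import numFieldNormedType.Exports.
Local Open Scope classical_set_scope.
Local Open Scope ring_scope.

Definition body {T : topologicalType} (A : set T) : Prop :=
  A !=set0 /\ A != setT /\ A `<=` closure (interior A) /\ connected (interior A).

Definition covering {T : topologicalType} (tau : set (set T)) : Prop :=
  (forall A, tau A -> A != setT) /\ \bigcup_(A in tau) A = setT.

Definition tiling {T : topologicalType} (tau : set (set T)) : Prop :=
  covering tau /\
  (forall A, tau A -> closed A /\ body A) /\
  (forall A B, tau A -> tau B -> A <> B -> interior A `&` interior B = set0).

Definition order_le2 {T : Type} (tau : set (set T)) : Prop :=
  forall (x : T) A B C, tau A -> tau B -> tau C -> A x -> B x -> C x ->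
    A = B \/ B = C \/ A = C.

(* Main.v *)
Require Import Defs.
From HB Require Import structures.
From mathcomp Require Import all_boot all_order all_algebra.
From mathcomp Require Import all_classical all_reals all_analysis.
From mathcomp Require Import lra zify.
Set Implicit Arguments. Unset Strict Implicit. Unset Printing Implicit Defensive.
Import Order.TTheory GRing.Theory Num.Theory.
Import numFieldNormedType.Exports.
Local Open Scope classical_set_scope.
Local Open Scope ring_scope.

(** Cut X into the closed unit ball and the shells k < |x| <= k+1, k >= 1. Well-order
    X, choose for each p a contractive functional f_p with f_p(p) = |p|, and send each
    point x of a shell to the first p with f_p(x) > k. This partitions X into the ball
    and disjoint sets of the form D n {f_p > k} with D closed, convex, bounded and
    containing the ball of radius k. Such a half-open piece is the union of the slices
    of D between consecutive levels a_0 > a_1 > ... -> k of f_p, where only consecutive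
    slices meet; since distinct pieces are disjoint, no point lies in three tiles. *)

(** * Hahn-Banach through minimal sublinear functionals *)

Definition sublinear {R : numDomainType} {V : lmodType R} (q : V -> R) : Prop :=
  (forall x y, q (x + y) <= q x + q y) /\
  (forall t x, 0 < t -> q (t *: x) <= t * q x).

Section HahnBanach.
Context {R : realType} {V : lmodType R}.
Implicit Types (p q : V -> R) (x y a : V).

(** Applying the inequality of the definition to [t^-1] and [t *: x] gives the converse one. *)
Lemma sublinearZ q t x : sublinear q -> 0 < t -> q (t *: x) = t * q x.
Proof.
move=> [_ qZ] t0; apply/le_anti; rewrite qZ//= -ler_pdivlMl//.
have := qZ t^-1 (t *: x); rewrite invr_gt0 => /(_ t0).
by rewrite scalerA mulVf ?gt_eqF// scale1r.
Qed.

Lemma sublinear0 q : sublinear q -> q 0 = 0.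
Proof.
move=> qs; have := @sublinearZ q 2 0 qs (ltr0Sn _ _).
by rewrite scaler0; lra.
Qed.

Lemma sublinear_oppr_le q x : sublinear q -> - q (- x) <= q x.
Proof.
by move=> qs; have := qs.1 x (- x); rewrite subrr sublinear0//; lra.
Qed.

(* A sublinear minorant of [q]; equality with [q] for all [a] forces additivity, so
   minimal sublinear functionals are linear. *)
Definition descend q a x := inf [set q (x + t *: a) - t * q a | t in [set t | 0 <= t]].

(** For [0 <= t], [t * q a = q (t *: a)] is at most [q (x + t *: a) + q (- x)]. *)
Lemma descend_has_lbound q a x : sublinear q ->
  has_lbound [set q (x + t *: a) - t * q a | t in [set t | 0 <= t]].
Proof.
move=> qs; exists (- q (- x)) => _ [t /= t0 <-].
have [->|tN0] := eqVneq t 0.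
  by rewrite scale0r addr0 mul0r subr0 sublinear_oppr_le.
have tp : 0 < t by rewrite lt_neqAle eq_sym tN0.
have := qs.1 (x + t *: a) (- x).
by rewrite addrAC subrr add0r sublinearZ//; lra.
Qed.

Lemma descend_le q a x t : sublinear q -> 0 <= t ->
  descend q a x <= q (x + t *: a) - t * q a.
Proof. by move=> qs t0; apply: ge_inf; [exact: descend_has_lbound|exists t]. Qed.

Lemma le_descend q a x r :
  (forall t, 0 <= t -> r <= q (x + t *: a) - t * q a) -> r <= descend q a x.
Proof.
move=> h; apply: lb_le_inf; first by exists (q (x + 0 *: a) - 0 * q a), 0 => /=.
by move=> _ [t /= t0 <-]; exact: h.
Qed.

Lemma descend_sublinear q a : sublinear q -> sublinear (descend q a).
Proof.
move=> qs; split=> [x y|t x t0].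
- rewrite -lerBlDr; apply: le_descend => s s0.
  rewrite lerBlDr -lerBlDl; apply: le_descend => u u0; rewrite lerBlDl.
  apply: (le_trans (descend_le a (x + y) qs (addr_ge0 s0 u0))).
  have := qs.1 (x + s *: a) (y + u *: a); rewrite addrACA -scalerDl.
  by rewrite mulrDl; lra.
- rewrite -ler_pdivrMl//; apply: le_descend => s s0.
  rewrite ler_pdivrMl//.
  apply: (le_trans (descend_le a (t *: x) qs (mulr_ge0 (ltW t0) s0))).
  by rewrite -scalerA -scalerDr sublinearZ// mulrBr mulrA.
Qed.

Lemma descend_le_id q a x : sublinear q -> descend q a x <= q x.
Proof.
move=> qs; apply: (le_trans (descend_le a x qs (lexx 0))).
by rewrite scale0r addr0 mul0r subr0.
Qed.

(** The pointwise infimum works: for subadditivity, of the two members approximating it at [x] and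
    at [y], the smaller one serves at both points. For the empty chain, [p] itself is taken. *)
Lemma sublinear_chain_inf p (A : set (V -> R)) : sublinear p ->
  (forall q, A q -> sublinear q /\ forall x, q x <= p x) ->
  (forall q q', A q -> A q' -> (forall x, q x <= q' x) \/ (forall x, q' x <= q x)) ->
  exists q, [/\ sublinear q, forall x, q x <= p x & forall q', A q' -> forall x, q x <= q' x].
Proof.
move=> ps As Atot; have [->|/set0P[q0 Aq0]] := eqVneq A set0.
  by exists p; split.
pose E x := [set q x | q in A].
have E0 x : E x !=set0 by exists (q0 x), q0.
have Elb x : has_lbound (E x).
  exists (- p (- x)) => _ [q Aq <-]; have [qs qp] := As q Aq.
  by apply: le_trans (sublinear_oppr_le _ qs); rewrite lerN2.
have infle q x : A q -> inf (E x) <= q x.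
  by move=> Aq; apply: ge_inf => //; exists q.
exists (fun x => inf (E x)); split => [|x|q Aq x].
- split=> [x y|t x t0].
  + rewrite -lerBlDr; apply: lb_le_inf => // _ [q Aq <-].
    rewrite lerBlDr -lerBlDl; apply: lb_le_inf => // _ [q' Aq' <-].
    rewrite lerBlDl.
    have [qq'|q'q] := Atot _ _ Aq Aq'.
    * apply: (le_trans (infle _ _ Aq)).
      by apply: (le_trans ((As _ Aq).1.1 _ _)); rewrite lerD2l.
    * apply: (le_trans (infle _ _ Aq')).
      by apply: (le_trans ((As _ Aq').1.1 _ _)); rewrite lerD2r.
  + rewrite -ler_pdivrMl//; apply: lb_le_inf => // _ [q Aq <-].
    by rewrite ler_pdivrMl//; apply: (le_trans (infle _ _ Aq)); exact: (As _ Aq).1.2.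
- by apply: (le_trans (infle _ _ Aq0)); exact: (As _ Aq0).2.
- exact: infle.
Qed.

Lemma minimal_sublinear p : sublinear p -> exists q,
  [/\ sublinear q, forall x, q x <= p x &
    forall q', sublinear q' -> (forall x, q' x <= q x) -> q' = q].
Proof.
move=> ps; pose T := {q | sublinear q /\ forall x, q x <= p x}.
(* The order is reversed, so that Zorn's maximal element is a minimal functional. *)
pose le (q q' : T) : bool := `[< forall x, sval q' x <= sval q x >].
have [||||[q [qs qp]] qmin] := @Zorn T le.
- by move=> t; apply/asboolP.
- move=> r s t /asboolP rs /asboolP st; apply/asboolP => x.
  exact: le_trans (st x) (rs x).
- move=> [s ?] [t ?] /asboolP/= st /asboolP/= ts; apply: eq_exist => /=.
  by apply/funext => x; apply/le_anti; rewrite st ts.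
- move=> A Atot.
  have [||q [qs qp qA]] := @sublinear_chain_inf p [set sval q | q in A] ps.
  + by move=> _ [q _ <-]; exact: (svalP q).
  + by move=> _ _ [q Aq <-] [q' Aq' <-]; case: (Atot _ _ Aq Aq') => /asboolP; auto.
  + exists (exist _ q (conj qs qp)) => s As; apply/asboolP => /= x.
    by apply: qA; exists s.
exists q; split => // q' q's q'q.
have q'p x : q' x <= p x by exact: le_trans (q'q x) (qp x).
have /(_ _)/(congr1 sval) := qmin (exist _ q' (conj q's q'p)).
by apply; apply/asboolP.
Qed.

Lemma minimal_sublinear_scalar q : sublinear q ->
  (forall q', sublinear q' -> (forall x, q' x <= q x) -> q' = q) -> scalar q.
Proof.
move=> qs qmin.
have qD x y : q (x + y) = q x + q y.
  apply/le_anti; rewrite qs.1/= -lerBrDr.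
  (* Minimality makes descending along [y] leave [q] unchanged; the parameter [t = 1] then gives
     [q x <= q (x + y) - q y]. *)
  have {1}<- : descend q y = q.
    by apply: qmin; [exact: descend_sublinear|move=> z; exact: descend_le_id].
  by have := descend_le y x qs ler01; rewrite scale1r mul1r.
have qN x : q (- x) = - q x.
  by apply/eqP; rewrite -addr_eq0 -qD addNr sublinear0.
move=> t x y; rewrite qD; congr (_ + _).
have [t0|t0|<-] := ltgtP 0 t; last by rewrite scale0r mul0r sublinear0.
- exact: sublinearZ.
- by rewrite -[t]opprK scaleNr qN sublinearZ ?oppr_gt0// -mulNr.
Qed.

End HahnBanach.

(* Any sublinear minorant of [descend `|_| p] is at most [- `|p|] at [- p]. *)
Lemma norming_functional {R : realType} {X : normedModType R} (p : X) :
  exists f : {scalar X}, (forall x, `|f x| <= `|x|) /\ f p = `|p|.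
Proof.
have ns : sublinear (fun x : X => `|x|).
  split=> [x y|t x t0]; first exact: ler_normD.
  by rewrite normrZ gtr0_norm.
have [f [fs fle fmin]] := minimal_sublinear (descend_sublinear p ns).
pose F := HB.pack_for {scalar X} f
  (GRing.isLinear.Build R X R _ f (minimal_sublinear_scalar fs fmin)).
have Fle x : F x <= `|x| by apply: le_trans (fle x) _; exact: descend_le_id.
have FN x : F (- x) = - F x by exact: linearN.
exists F; split=> [x|].
  by rewrite ler_norml Fle andbT lerNl -FN -(normrN x) Fle.
apply/le_anti; rewrite Fle/= -lerN2 -FN.
apply: (le_trans (fle _)); apply: (le_trans (descend_le p (- p) ns ler01)).
by rewrite scale1r addNr normr0 mul1r sub0r.
Qed.

(** * Convex bodies in a normed space *)

Section ConvexBody.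
Context {R : realType} {X : normedModType R}.
Implicit Types (A : set X) (x y z u : X).

(** A plain real parameter replaces the bundled one of [convex_set], which suits computations with
    norms and functionals. *)
Definition segment_closed A := forall x y (t : R), A x -> A y ->
  0 <= t -> t <= 1 -> A (x + t *: (y - x)).

Lemma segment_closed_convex_set A :
  segment_closed A -> convex_set (A : set (convex_lmodType X)).
Proof.
move=> cA x y t /set_mem Ax /set_mem Ay; apply/mem_set.
have -> : conv t x y = y + t%:num *: (x - y) :> X.
  by rewrite /conv/= /unstable.onem scalerBl scale1r scalerBr addrCA.
exact: cA.
Qed.

(** The homothety with centre [x] and ratio [t] maps a ball of radius [e] around [y] inside [A] onto
    a ball of radius [t * e], still inside [A]. *)
Lemma interior_segment A x y (t : R) : segment_closed A -> A x ->
  interior A y -> 0 < t -> t <= 1 -> interior A (x + t *: (y - x)).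
Proof.
move=> cA Ax /nbhs_ballP[e /= e0 yA] t0 t1; apply/nbhs_ballP; exists (t * e).
  exact: mulr_gt0.
move=> z; rewrite -ball_normE/= => zt.
have -> : z = x + t *: ((x + t^-1 *: (z - x)) - x).
  by rewrite addrAC subrr add0r scalerA divff ?gt_eqF// scale1r addrC subrK.
apply: cA => //; [apply: yA|exact: ltW].
rewrite -ball_normE/= -(ltr_pM2l t0) -{1}(gtr0_norm t0) -normrZ.
rewrite opprD addrA scalerBr scalerA divff ?gt_eqF// scale1r.
by rewrite opprB addrCA addrA.
Qed.

Lemma segment_closed_interior A : segment_closed A -> segment_closed (interior A).
Proof.
move=> cA x y t Ax Ay t0 t1; have [->|tN0] := eqVneq t 0.
  by rewrite scale0r addr0.
apply: interior_segment => //; first exact: interior_subset Ax.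
by rewrite lt_neqAle eq_sym tN0.
Qed.

(** Such a set is the union of the segments issuing from one of its points. *)
Lemma segment_closed_connected A : segment_closed A -> connected A.
Proof.
move=> cA; have [->|/set0P[x Ax]] := eqVneq A set0; first exact: connected0.
pose seg y := [set x + t *: (y - x) | t in `[0, 1]%classic].
have -> : A = \bigcup_(y in A) seg y.
  apply/seteqP; split=> [y Ay|_ [y Ay [t /= + <-]]].
    exists y => //; exists 1; first by rewrite /= in_itv/= ler01 lexx.
    by rewrite scale1r addrC subrK.
  by rewrite in_itv/= => /andP[t0 t1]; exact: cA.
apply: bigcup_connected => [|y Ay].
  exists x => y Ay; exists 0; first by rewrite /= in_itv/= ler01 lexx.
  by rewrite scale0r addr0.
apply: connected_continuous_connected; first exact: segment_connected.
apply: continuous_subspaceT => t; apply: cvgD; first exact: cvg_cst.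
by apply: cvgZr_tmp; exact: cvg_id.
Qed.

Lemma segment_closed_sub_closure A : segment_closed A -> interior A !=set0 ->
  A `<=` closure (interior A).
Proof.
move=> cA [y Ay] x Ax B /nbhs_ballP[e /= e0 xB].
(* The first bound keeps the point on the segment, the second puts it within [e] of [x]; the [+ 1]
   covers the case [y = x]. *)
pose t := Num.min 1 (e / (2 * (`|y - x| + 1))).
have d0 : 0 < 2 * (`|y - x| + 1) by rewrite mulr_gt0// ltr_wpDl.
have t0 : 0 < t by rewrite lt_min ltr01 divr_gt0.
exists (x + t *: (y - x)); split.
  by apply: interior_segment => //; rewrite ge_min lexx.
apply: xB; rewrite -ball_normE/= opprD addrA subrr add0r normrN normrZ gtr0_norm//.
have : t <= e / (2 * (`|y - x| + 1)) by rewrite ge_min lexx orbT.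
rewrite ler_pdivlMr//; have := normr_ge0 (y - x); nra.
Qed.

Lemma bounded_set_neqT A : (exists x : X, x != 0) -> bounded_set A -> A != setT.
Proof.
move=> [x x0] [M [Mr MA]]; apply/eqP => AT.
have M1 : M < Num.max M 0 + 1 by rewrite ltr_pwDr// le_max lexx.
(* This multiple of [x] has norm [max M 0 + 2], beyond the bound [max M 0 + 1]; the maximum covers a
   negative [M]. *)
have := MA _ M1 (((Num.max M 0 + 2) / `|x|) *: x).
rewrite AT => /(_ I) /=; rewrite normrZ normrM normfV normr_id -mulrA mulVf ?normr_eq0//.
rewrite mulr1 ger0_norm; last by rewrite addr_ge0// le_max lexx orbT.
by rewrite lerD2l; lra.
Qed.

Definition tile A : Prop :=
  closed A /\ body A /\ convex_set (A : set (convex_lmodType X)) /\ bounded_set A.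

Lemma segment_closed_tile A : (exists x : X, x != 0) -> closed A -> bounded_set A ->
  segment_closed A -> interior A !=set0 -> tile A.
Proof.
move=> X0 clA bA cA iA; split=> //; split; last first.
  by split=> //; exact: segment_closed_convex_set.
split; first by case: iA => x /interior_subset Ax; exists x.
split; first exact: bounded_set_neqT.
split; first exact: segment_closed_sub_closure.
exact/segment_closed_connected/segment_closed_interior.
Qed.

Lemma closed_norm_le (r : R) : closed [set x : X | `|x| <= r].
Proof.
have clr : closed [set s : R | s <= r] by exact: closed_le.
by apply: preimage_closed clr => x _; exact: norm_continuous.
Qed.

Lemma bounded_norm_le (r : R) : bounded_set [set x : X | `|x| <= r].
Proof.
exists r; split=> [|s rs x /= xr]; first exact: num_real.
exact: le_trans xr (ltW rs).
Qed.

Lemma segment_closed_norm_le (r : R) : segment_closed [set x : X | `|x| <= r].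
Proof.
move=> x y t /= xr yr t0 t1.
have -> : x + t *: (y - x) = (1 - t) *: x + t *: y.
  by rewrite scalerBl scale1r scalerBr addrAC addrA.
apply: (le_trans (ler_normD _ _)); rewrite !normrZ !ger0_norm ?subr_ge0//; nra.
Qed.

Lemma contractive_scalar_continuous (f : {scalar X}) :
  (forall x, `|f x| <= `|x|) -> continuous (f : X -> R).
Proof.
move=> fle x; apply/cvgrPdist_lt => e e0; near=> y.
rewrite -linearB; apply: (le_lt_trans (fle _)); near: y.
exact: cvgr_dist_lt.
Unshelve. all: by end_near. Qed.

Lemma closed_scalar_le (f : {scalar X}) (r : R) :
  continuous (f : X -> R) -> closed [set x | f x <= r].
Proof.
have clr : closed [set s : R | s <= r] by exact: closed_le.
by move=> fc; apply: preimage_closed clr => x _; exact: fc.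
Qed.

Lemma segment_closed_scalar_le (f : {scalar X}) (r : R) :
  segment_closed [set x | f x <= r].
Proof.
by move=> x y t /= xr yr t0 t1; rewrite linearD linearZ linearB/=; nra.
Qed.

Lemma closed_unit_ball_tile : (exists x : X, x != 0) -> tile [set x : X | `|x| <= 1].
Proof.
move=> X0; apply: segment_closed_tile => //.
- exact: closed_norm_le.
- exact: bounded_norm_le.
- exact: segment_closed_norm_le.
- exists 0; apply/nbhs_ballP; exists 1 => //= x.
  by rewrite -ball_normE/= sub0r normrN => /ltW.
Qed.

End ConvexBody.

(** * Subsets that are unions of order 2 families of tiles *)

Section Order2Tiling.
Context {R : realType} {X : normedModType R}.
Implicit Types (C D : set X) (x y z : X).

(** Stated for arbitrary subsets, closed or not, so that the pieces of a partition can be tiled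
    separately. *)
Definition order2_tilable C : Prop := exists tau : set (set X),
  [/\ \bigcup_(A in tau) A = C,
      forall A, tau A -> tile A,
      forall A B, tau A -> tau B -> A <> B -> interior A `&` interior B = set0 &
      order_le2 tau].

Lemma order2_tilable0 : order2_tilable set0.
Proof.
by exists set0; split=> //; rewrite bigcup_set0.
Qed.

Lemma tile_order2_tilable C : tile C -> order2_tilable C.
Proof.
move=> tC; exists [set C]; split; first by rewrite bigcup_set1.
- by move=> A ->.
- by move=> A B -> ->.
- by move=> x A B ? -> ->; left.
Qed.

(** Each tile stays inside its piece and the pieces are disjoint, so all tiles through a given point
    belong to one piece. *)
Lemma order2_tilable_bigcup (I : Type) (F : I -> set X) :
  (forall i, order2_tilable (F i)) ->
  (forall i j x, F i x -> F j x -> i = j) ->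
  order2_tilable (\bigcup_i F i).
Proof.
move=> tF disjF; have [tau tauP] := choice tF.
have tauF i A x : tau i A -> A x -> F i x.
  by move=> tA Ax; have [<- _ _ _] := tauP i; exists A.
exists (\bigcup_i tau i); split.
- rewrite bigcup_bigcup; apply: eq_bigcupr => i _.
  by have [] := tauP i.
- by move=> A [i _ tA]; have [_ + _ _] := tauP i; apply.
- move=> A B [i _ tA] [j _ tB] AB; apply/seteqP; split=> // x [Ax Bx].
  have ij : i = j.
    by apply: (disjF _ _ x); [exact: tauF tA (interior_subset Ax)|
                              exact: tauF tB (interior_subset Bx)].
  have [_ _ + _] := tauP i => /(_ A B tA) <-//; by rewrite ij.
- move=> x A B C [i _ tA] [j _ tB] [k _ tC] Ax Bx Cx.
  have ij : i = j by apply: (disjF _ _ x); [exact: tauF tA Ax|exact: tauF tB Bx].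
  have ik : i = k by apply: (disjF _ _ x); [exact: tauF tA Ax|exact: tauF tC Cx].
  have [_ _ _ /(_ x A B C tA)] := tauP i.
  by apply => //; [rewrite ij|rewrite ik].
Qed.

(* The tiles are slices of [D] between the levels [k + (c - k) / n.+1] of [f],
   which decrease to [k] without reaching it. *)
Lemma halfopen_order2_tilable D (f : {scalar X}) (k : R) o :
  (exists x : X, x != 0) -> (forall x, `|f x| <= `|x|) ->
  closed D -> bounded_set D -> segment_closed D ->
  interior D o -> f o <= k ->
  order2_tilable (D `&` [set x | k < f x]).
Proof.
move=> X0 fle clD bD cD Do fok.
have [->|/set0P[x0 [Dx0 /= fx0]]] := eqVneq (D `&` [set x | k < f x]) set0.
  exact: order2_tilable0.
pose c := f x0.
have kc : 0 < c - k by rewrite subr_gt0.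
pose a n : R := k + (c - k) / n.+1%:R.
have ak n : k < a n by rewrite ltrDl divr_gt0// ltr0Sn.
have ac n : a n <= c.
  rewrite -lerBrDl ler_pdivrMr ?ltr0Sn// ler_peMr ?ler1n//; exact: ltW.
have alt n m : (n < m)%N -> a m < a n.
  move=> nm; rewrite ltrD2l ltr_pM2l// ltf_pV2 ?posrE ?ltr0Sn//.
  by rewrite ltr_nat.
have ale n m : (n <= m)%N -> a m <= a n.
  by rewrite leq_eqVlt => /predU1P[->//|/alt/ltW].
(* The top slice has no upper bound, since [f] may exceed [a 0 = c] on [D]. *)
pose T n := D `&` [set x | a n.+1 <= f x] `&` [set x | n = 0%N \/ f x <= a n].
have Tlt n m x : T n x -> T m x -> (n < m)%N -> m = n.+1 /\ f x = a n.+1.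
  move=> [[_ /= an] _] [_ /= [->//|fxm]] nm.
  have anm : a n.+1 <= a m by exact: le_trans an fxm.
  have mn : m = n.+1.
    by apply/eqP; rewrite eqn_leq nm andbT leqNgt; apply/negP => /alt; rewrite ltNge anm.
  by split=> //; apply/le_anti; rewrite an andbT -mn.
have fcont := contractive_scalar_continuous fle.
have fclosed (B : set R) : closed B -> closed (f @^-1` B).
  by move=> clB; apply: preimage_closed clB => x _; exact: fcont.
(* The segment from [x0] to the interior point [o] crosses the middle level [v] at a point [z]
   interior to [D]; [t] solves [f z = v]. *)
have intT n : interior (T n) !=set0.
  pose v := (a n.+1 + a n) / 2.
  have an1 : a n.+1 < a n by exact: alt.
  have v1 : a n.+1 < v by rewrite /v; lra.
  have v2 : v < a n by rewrite /v; lra.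
  have foc : 0 < c - f o by lra.
  pose t := (v - f o) / (c - f o).
  have ak1 := ak n.+1; have acn := ac n.
  have t0 : 0 < t by rewrite divr_gt0//; lra.
  have t1 : t < 1 by rewrite ltr_pdivrMr//; lra.
  pose z := x0 + (1 - t) *: (o - x0).
  have fz : f z = v.
    rewrite /z linearD linearZ linearB/= -/c.
    have : t * (c - f o) = v - f o by rewrite divfK// gt_eqF.
    by lra.
  have Dz : interior D z by apply: interior_segment => //; lra.
  have lo : \forall y \near z, a n.+1 < f y.
    by apply: (cvgr_gt _ (fcont z)); rewrite fz.
  have hi : \forall y \near z, f y < a n.
    by apply: (cvgr_lt _ (fcont z)); rewrite fz.
  exists z; apply: filterS (filterI Dz (filterI lo hi)) => y [Dy [/ltW lo_y /ltW hi_y]].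
  by split; [split|right].
(* A set with an interior point lies in no level set of [f], because [f] varies along [u]:
   [f u = c - f o > 0]. *)
have flat z (e : R) A : interior A z -> ~ (forall y, A y -> f y = e).
  move=> Az Ae; pose u := x0 - o.
  have : \forall h \near (0 : R), A (z + h *: u).
    suff : (fun h : R => z + h *: u) @ (0 : R) --> z by apply.
    rewrite -[X in _ --> X]addr0 -(scale0r u).
    by apply: cvgD; [exact: cvg_cst|apply: cvgZr_tmp; exact: cvg_id].
  move=> /nbhs_ballP[r /= r0 rA].
  have h1 : ball (0 : R) r (r / 2).
    by rewrite -ball_normE/= sub0r normrN gtr0_norm; lra.
  have := Ae _ (rA _ h1); have := Ae _ (interior_subset Az).
  rewrite linearD linearZ linearB/= -/c => -> /eqP.
  by rewrite -subr_eq0 addrC addKr mulf_eq0; lra.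
exists (range T); split.
- rewrite bigcup_image; apply/seteqP; split=> [x [n _ [[Dx /= anx] _]]|x [Dx /= kx]].
    by split=> //=; exact: lt_le_trans anx.
  have ex_n : exists n, a n.+1 <= f x.
    have [|n] := @ltr_add_invr R 0 ((f x - k) / (c - k)); first by rewrite divr_gt0// subr_gt0.
    rewrite add0r ltr_pdivlMr// mulrC => /ltW nx; exists n.
    by apply: (le_trans (ale _ _ (leqnSn n))); rewrite /a -lerBrDl.
  (* If [f x] exceeded [a n] with [n > 0], the index [n - 1] would already qualify. *)
  case: (ex_minnP ex_n) => n an nmin; exists n => //; split=> //=.
  case: n nmin {an} => [|n] nmin; [by left|right].
  by rewrite leNgt; apply/negP => /ltW /nmin; rewrite ltnn.
- move=> _ [n _ <-]; apply: segment_closed_tile => //.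
  + apply: closedI; first apply: closedI => //.
      exact: (fclosed _ (@closed_ge _ (a n.+1))).
    have [->|n0] := eqVneq n 0%N.
      rewrite (_ : mkset _ = setT); first exact: closedT.
      by apply/seteqP; split=> // x _; left.
    rewrite (_ : mkset _ = f @^-1` [set r | r <= a n]).
      exact: (fclosed _ (@closed_le _ (a n))).
    by apply/seteqP; split=> [x [/eqP|//]|x]; [rewrite (negbTE n0)|right].
  + by have [M [Mr MD]] := bD; exists M; split=> // r /MD bDr x [[/bDr]].
  + move=> x y t [[Dx /= ax] nx] [[Dy /= ay] ny] t0 t1.
    split; [split => //=; first exact: cD|].
      by rewrite linearD linearZ linearB/=; nra.
    case: nx ny => [->|nx] [n0|ny]; [by left|by left|by left|right].
    by rewrite linearD linearZ linearB/=; nra.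
- move=> _ _ [n _ <-] [m _ <-] nm; apply/seteqP; split=> // x [nx mx].
  wlog lt_nm : n m nm nx mx / (n < m)%N.
    move=> H; have [lt_nm|lt_mn|eq_nm] := ltngtP n m; first exact: (H n m).
      by apply: (H m n) => // eq_mn; apply: nm.
    by rewrite eq_nm in nm.
  (* A common interior point would be interior to the intersection, on which [f] is constantly
     [a n.+1]. *)
  apply: (flat x (a n.+1) (T n `&` T m)); first by apply: filterI.
  by move=> y [ny my]; have [] := Tlt _ _ _ ny my lt_nm.
- move=> x _ _ _ [n _ <-] [m _ <-] [l _ <-] nx mx lx.
  have nbr i j : T i x -> T j x -> [|| i == j, j == i.+1 | i == j.+1].
    move=> ix jx; have [ij|ji|->] := ltngtP i j; last by [].
      by have [-> _] := Tlt _ _ _ ix jx ij; rewrite eqxx orbT.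
    by have [-> _] := Tlt _ _ _ jx ix ji; rewrite eqxx !orbT.
  (* Three distinct naturals cannot be pairwise consecutive. *)
  suff [->|[->|->]] : n = m \/ m = l \/ n = l by tauto.
  by have := nbr _ _ nx mx; have := nbr _ _ mx lx; have := nbr _ _ nx lx; lia.
Unshelve. all: by end_near. Qed.
End Order2Tiling.

(** * The cells of a shell *)

Section Cells.
Context {R : realType} {X : normedModType R}.
Implicit Types (f : X -> {scalar X}) (prec : rel X) (k : nat) (p : X).

(* [~~ prec p q] says that [q] strictly precedes [p]. The cell collects the points of
   the shell [k.+1 < `|x| <= k.+2] for which [f p] is the first functional exceeding
   [k.+1]; [cell_closure] need not be its topological closure. *)
Definition cell_closure f prec k p : set X := [set x | `|x| <= k.+2%:R] `&`
  \bigcap_(q in [set q | ~~ prec p q]) [set x | f q x <= k.+1%:R].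

Definition cell f prec k p : set X := cell_closure f prec k p `&` [set x | k.+1%:R < f p x].

(** The origin serves as interior point: the functionals are contractive and [1 <= k.+1], so the
    unit ball lies in [cell_closure]. *)
Lemma cell_order2_tilable f prec k p : (exists x : X, x != 0) ->
  (forall q x, `|f q x| <= `|x|) -> order2_tilable (cell f prec k p).
Proof.
move=> X0 fle; apply: (@halfopen_order2_tilable _ _ _ _ _ 0) => //.
- apply: closedI; first exact: closed_norm_le.
  apply: closed_bigI => q _; apply: closed_scalar_le.
  exact: contractive_scalar_continuous.
- have [M [Mr MD]] := @bounded_norm_le _ X k.+2%:R.
  by exists M; split=> // r /MD Dr x [/Dr].
- move=> x y t [xk fx] [yk fy] t0 t1; split; first exact: segment_closed_norm_le.
  by move=> q pq; apply: segment_closed_scalar_le => //; [exact: fx|exact: fy].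
- apply/nbhs_ballP; exists 1 => //= x.
  rewrite -ball_normE/= sub0r normrN => /ltW x1.
  have x1k : `|x| <= k.+1%:R by rewrite (le_trans x1)// ler1n.
  split=> [/=|q _ /=]; first by rewrite (le_trans x1k)// ler_nat.
  by rewrite (le_trans (ler_norm _))// (le_trans (fle _ _)).
- by rewrite linear0.
Qed.

End Cells.

(** * Well-ordering and assembly of the tiling *)

Lemma well_order_min {T : Type} (prec : rel T) (P : set T) : wochoice.well_order prec ->
  P !=set0 -> exists2 x, P x & forall y, P y -> prec x y.
Proof.
move=> wo [x Px]; have [|y [[/asboolP Py ymin] _]] := wo (fun x => `[< P x >]).
  by exists x; exact/asboolP.
by exists y => // z Pz; apply: ymin; exact/asboolP.
Qed.

Unset Implicit Arguments.

Theorem mainTheorem1 (R : realType) (X : completeNormedModType R)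
  (hX : exists x : X, x != 0) :
  exists tau : set (set X),
    tiling tau /\ order_le2 tau /\
    (forall A, tau A -> closed A /\ convex_set (A : set (convex_lmodType X))
                      /\ bounded_set A).
Proof.
have [f fP] := choice (@norming_functional R X).
have fle p x : `|f p x| <= `|x| by exact: (fP p).1.
have [prec wo] := wochoice.well_ordering_principle X.
pose F (i : option (nat * X)) : set X :=
  if i is Some (k, p) then cell f prec k p else [set x | `|x| <= 1].
have anti p q : prec p q -> prec q p -> p = q.
  move=> pq qp; apply: (@wochoice.wo_chain_antisymmetric _ prec predT) => //.
    exact: wochoice.withinW.
  by rewrite pq qp.
have cell_norm_gt k p x : cell f prec k p x -> k.+1%:R < `|x|.
  by move=> [_ /lt_le_trans]; apply; exact: le_trans (ler_norm _) (fle _ _).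
have cell_prec k p q x : cell f prec k p x -> k.+1%:R < f q x -> prec p q.
  by move=> [[_ xp] _] qx; apply: contraT => /xp /=; rewrite leNgt qx.
(* The norm of [x] determines the shell; within a shell, each of the two indices precedes the
   other. *)
have disjF i j x : F i x -> F j x -> i = j.
  case: i j => [[k p]|] [[l q]|] //= xi xj.
  - have kl : k = l.
      have := lt_le_trans (cell_norm_gt _ _ _ xi) xj.1.1.
      have := lt_le_trans (cell_norm_gt _ _ _ xj) xi.1.1.
      by rewrite !ltr_nat; lia.
    subst l; congr (Some (_, _)); apply: anti.
      exact: cell_prec xi xj.2.
    exact: cell_prec xj xi.2.
  - by have := lt_le_trans (cell_norm_gt _ _ _ xi) xj; rewrite ltrn1.
  - by have := lt_le_trans (cell_norm_gt _ _ _ xj) xi; rewrite ltrn1.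
have coverF : \bigcup_i F i = setT.
  apply/seteqP; split=> // x _.
  have ex_n : exists n, `|x| <= n.+1%:R.
    exists (Num.bound `|x|); apply: ltW.
    by apply: (lt_trans (archi_boundP (normr_ge0 x))); rewrite ltr_nat.
  (* A least bound of 1 puts [x] in the ball; otherwise it is [k.+2], and minimality gives
     [k.+1 < |x|]. *)
  case: (ex_minnP ex_n) => -[|k] xk kmin; first by exists None.
  have kx : k.+1%:R < `|x| by rewrite ltNge; apply/negP => /kmin; rewrite ltnn.
  (* The set of candidates contains [x] itself, since [f x x = |x|]. *)
  have [|p kp pmin] := @well_order_min _ prec [set p | k.+1%:R < f p x] wo.
    by exists x => /=; rewrite (fP x).2.
  exists (Some (k, p)) => //; split=> //; split=> // q /= pq.
  by rewrite leNgt; apply: contra pq => /pmin.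
have tF i : order2_tilable (F i).
  case: i => [[k p]|]; first exact: cell_order2_tilable.
  exact/tile_order2_tilable/closed_unit_ball_tile.
have [tau [tauT tauP tauI tau2]] := order2_tilable_bigcup tF disjF.
exists tau; split; [split; [split|split] => //|split=> //].
- by move=> A /tauP[_ [[_ []]]].
- by rewrite tauT.
- by move=> A /tauP[? []].
- by move=> A /tauP[? [_ []]].
Qed.
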